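(* For every integer $n\ge 0$, \[ \overline{p}_o(2n+1)=2\sum_{k=0}^{\infty}\overline{p}\bigl(n-2k(k+1)\bigr). \]
   Context: An overpartition of $n$ is a partition of $n$ in which the first occurrence of each part size may be overlined. $\overline{p}(n)$ is the number of overpartitions of $n$, with $\sum_{n\ge0}\overline{p}(n)q^n=\frac{(-q;q)_\infty}{(q;q)_\infty}$; $\overline{p}_o(n)$ is the number of overpartitions of $n$ into odd parts, with $\sum_{n\ge0}\overline{p}_o(n)q^n=\frac{(-q;q^2)_\infty}{(q;q^2)_\infty}$, where $(a;q)_\infty=\prod_{k\ge1}(1-aq^{k-1})$. Convention: $\overline{p}(x)=0$ whenever $x$ is not a nonnegative integer. *)

(* Defs.v *)
From mathcomp Require Import all_boot all_order all_algebra.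
From mathcomp Require Import all_classical.

Set Implicit Arguments.
Unset Strict Implicit.
Unset Printing Implicit Defensive.

(* An overpartition is the nonincreasing sequence of its parts, each part
   paired with a boolean telling whether it is overlined.  The last condition
   says that an overlined part is preceded by no part of the same size, i.e.
   that only a first occurrence may be overlined. *)
Definition is_overpartition (n : nat) (s : seq (nat * bool)) : bool :=
  [&& sorted geq (unzip1 s),
      all (fun p => 0 < p) (unzip1 s),
      sumn (unzip1 s) == n
    & pairwise (fun x y => y.2 ==> (x.1 != y.1)) s].

(* Since the parts are positive and add up to n, an overpartition of n has at
   most n parts, each at most n (see is_overpartition_bounded), so restricting
   to this finite type loses nothing. *)
Definition overpartitions (n : nat) : {set n.-bseq ('I_n.+1 * bool)} :=
  [set s : n.-bseq ('I_n.+1 * bool)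
     | is_overpartition n [seq (val x.1, x.2) | x <- s]]%SET.

Definition pbar (x : int) : nat :=
  match x with
  | Posz n => #|overpartitions n|
  | Negz _ => 0
  end.

Definition pbar_o (n : nat) : nat :=
  #|[set s in overpartitions n | all (fun x => odd (val x.1)) s]%SET|.

Lemma is_overpartition_bounded (n : nat) (s : seq (nat * bool)) :
  is_overpartition n s -> size s <= n /\ all (fun p => p <= n) (unzip1 s).
Proof.
case/and4P=> _ pos /eqP <- _; rewrite -(size_map fst s) -/(unzip1 s).
elim: (unzip1 s) pos => //= p t IH /andP[p0 /IH[szt leN]]; split.
  by rewrite -add1n leq_add.
rewrite leq_addr /=; apply: sub_all leN => q /leq_trans; apply.
exact: leq_addl.
Qed.

(* The infinite sum of the theorem has finite support, so that the finitely
   supported sum over all of nat is its honest value. *)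
Lemma pbar_summand_eq0 (n k : nat) :
  n < k -> pbar (n%:Z - (2 * k * (k + 1))%N%:Z)%R = 0.
Proof.
move=> nk; have lt : n < 2 * k * (k + 1).
  by apply: leq_trans nk _; rewrite mulnAC leq_pmull // muln_gt0 addn1.
rewrite -GRing.opprB subzn ?(ltnW lt) //.
by move: lt; rewrite -subn_gt0; case: (_ - n).
Qed.

(* Main.v *)
Require Import Defs.
From mathcomp Require Import all_boot all_order all_algebra.
From mathcomp Require Import all_classical.
From mathcomp Require Import zify ring.

Set Implicit Arguments.
Unset Strict Implicit.
Unset Printing Implicit Defensive.

Import GRing.Theory.

(* Let theta(q) be the sum of q^(j^2) over all integers j.  By the Jacobi
   triple product, theta(q) = (-q;q^2)^2 (q^2;q^2), and by Euler
   (q;q^2) (-q;q^2) (-q^2;q^2) = 1, so that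
     (-q;q^2) / (q;q^2) = theta(q) (-q^2;q^2) / (q^2;q^2),
   i.e. the generating function of pbar_o at q is theta(q) times that of pbar
   at q^2.  In odd degree only odd j = 2k+1 or -(2k+1) contribute, and
   (2k+1)^2 = 4k(k+1) + 1.
   Power series are polynomials compared below a fixed degree, and the triple
   product is obtained from the q-binomial theorem. *)

(** * Recurrences for overpartitions with parts in a given set and of bounded size *)

Definition overpartition_in (S : pred nat) (m n : nat) (s : seq (nat * bool)) :=
  is_overpartition n s && all (fun x => S x.1 && (x.1 <= m)) s.

(* These are the sequences that may follow an initial part of size m. *)
Definition overpartition_in_plain (S : pred nat) (m n : nat)
    (s : seq (nat * bool)) :=
  overpartition_in S m n s && all (fun x => x.2 ==> (m != x.1)) s.

(** The carrier type depends on n; decoding into plain sequences lets overpartitions of different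
    numbers be compared and counted by list sizes. *)
Definition bounded_seqs (n : nat) (P : pred (seq (nat * bool))) :=
  [seq [seq (val x.1, x.2) | x <- val s]
     | s <- enum [set s : n.-bseq ('I_n.+1 * bool)
                    | P [seq (val x.1, x.2) | x <- s]]%SET].

Definition count_in S m n := size (bounded_seqs n (overpartition_in S m n)).

Definition count_in_plain S m n :=
  size (bounded_seqs n (overpartition_in_plain S m n)).

Lemma bounded_seqs_uniq n P : uniq (bounded_seqs n P).
Proof.
rewrite map_inj_uniq ?enum_uniq // => s t.
have inj : injective (fun x : 'I_n.+1 * bool => (val x.1, x.2)).
  by move=> [i b] [j c] [/= /val_inj -> ->].
by move=> /(inj_map inj) /val_inj.
Qed.

Lemma mem_bounded_seqs n (P : pred (seq (nat * bool))) s :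
  (forall t, P t -> is_overpartition n t) -> (s \in bounded_seqs n P) = P s.
Proof.
move=> Pn; apply/mapP/idP => [[t]|Ps].
  by rewrite mem_enum inE => Pt ->.
have [szs lesn] := is_overpartition_bounded (Pn _ Ps).
pose u := [seq (inord x.1 : 'I_n.+1, x.2) | x <- s].
have szu : size u <= n by rewrite size_map.
have us : [seq (val x.1, x.2) | x <- u] = s.
  rewrite -map_comp -[RHS]map_id; apply/eq_in_map => -[p b] /= pbs.
  by rewrite inordK // ltnS; apply: (allP lesn p); apply/mapP; exists (p, b).
by exists (Bseq szu); rewrite ?mem_enum ?inE /= ?us.
Qed.

Lemma mem_overpartition_in (S : pred nat) m n s :
  (s \in bounded_seqs n (overpartition_in S m n)) = overpartition_in S m n s.
Proof. by apply: mem_bounded_seqs => t /andP[]. Qed.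

Lemma mem_overpartition_in_plain (S : pred nat) m n s :
  (s \in bounded_seqs n (overpartition_in_plain S m n)) =
  overpartition_in_plain S m n s.
Proof. by apply: mem_bounded_seqs => t /andP[/andP[]]. Qed.

Lemma is_overpartition_cons n p b t :
  is_overpartition n ((p, b) :: t) =
  [&& 0 < p, p <= n, is_overpartition (n - p) t, all (fun x => x.1 <= p) t
    & all (fun x => x.2 ==> (p != x.1)) t].
Proof.
rewrite /is_overpartition !(sorted_pairwise (rev_trans leq_trans)) /=.
rewrite all_map.
have -> : (p + sumn (unzip1 t) == n) = (p <= n) && (sumn (unzip1 t) == n - p).
  by apply/idP/idP; lia.
rewrite (_ : all (preim _ _) t = all (fun x => x.1 <= p) t) //.
by lia.
Qed.

Lemma overpartition_in_cons (S : pred nat) m n p b t :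
  overpartition_in S m n ((p, b) :: t) =
  [&& 0 < p, p <= n, S p, p <= m & overpartition_in_plain S p (n - p) t].
Proof.
rewrite /overpartition_in_plain /overpartition_in is_overpartition_cons /=.
have [pm|] := leqP p m; last by rewrite !andbF.
have -> : all (fun x => S x.1 && (x.1 <= p)) t =
   all (fun x => x.1 <= p) t && all (fun x => S x.1 && (x.1 <= m)) t.
  rewrite -all_predI; apply: eq_all => x /=.
  by case: (S _); rewrite ?andbF //=; apply/idP/idP; lia.
by case: (0 < p) (p <= n) (S p) => [] [] [] //=; rewrite ?andbF // -!andbA;
  do !bool_congr.
Qed.

(** Parts do not increase, so a first part below [m] keeps [m] out of the tail and the extra
    condition is vacuous. When the first part is [m], that condition forbids its overline. *)
Lemma overpartition_in_plain_cons (S : pred nat) m n p b t : 0 < m -> S m ->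
  overpartition_in_plain S m n ((p, b) :: t) =
  if p == m then [&& ~~ b, m <= n & overpartition_in_plain S m (n - m) t]
  else overpartition_in S m.-1 n ((p, b) :: t).
Proof.
move=> m0 Sm; rewrite {1}/overpartition_in_plain !overpartition_in_cons /=.
case: (eqVneq p m) => [->|pm] /=.
  rewrite m0 Sm leqnn /= implybF; case: b; rewrite ?andbF //=.
  case: (m <= n) => //=.
  by apply: andb_idr => /andP[].
rewrite implybT /=.
have -> : (p <= m.-1) = (p <= m) by apply/idP/idP; lia.
case: (boolP (p <= m)) => lepm; rewrite ?andbF //=.
case: (0 < p) (p <= n) (S p) => [] [] [] //=.
apply: andb_idr => /andP[/andP[_ /allP tp] _].
apply/allP => x /tp /andP[_ xp]; apply/implyP => _.
by apply/eqP; lia.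
Qed.

Definition first_part_seqs (S : pred nat) m n (b : bool) :=
  if m <= n then
    map (cons (m, b))
      (bounded_seqs (n - m) (overpartition_in_plain S m (n - m)))
  else [::].

Lemma mem_first_part_seqs (S : pred nat) m n b s : 0 < m ->
  (s \in first_part_seqs S m n b) =
  [&& m <= n, head (0, b) s == (m, b)
    & overpartition_in_plain S m (n - m) (behead s)].
Proof.
move=> m0; rewrite /first_part_seqs; case: leqP => //= mn.
apply/mapP/andP => [[t]|].
  by rewrite mem_overpartition_in_plain => Pt -> /=; rewrite eqxx.
case: s => [|x t] /= [/eqP]; first by case; lia.
by move=> -> Pt; exists t => //; rewrite mem_overpartition_in_plain.
Qed.

Lemma first_part_seqs_uniq (S : pred nat) m n b :
  uniq (first_part_seqs S m n b).
Proof.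
rewrite /first_part_seqs; case: leqP => // _.
by rewrite map_inj_uniq ?bounded_seqs_uniq // => ? ? [].
Qed.

Lemma size_first_part_seqs (S : pred nat) m n b :
  size (first_part_seqs S m n b) =
  if m <= n then count_in_plain S m (n - m) else 0.
Proof. by rewrite /first_part_seqs; case: leqP => // _; rewrite size_map. Qed.

(** An overpartition either avoids [m] or begins with it. The leading [m] may be overlined or not,
    whence the doubling, and no later [m] may be overlined. *)
Lemma count_in_recl (S : pred nat) m n : 0 < m -> S m ->
  count_in S m n = count_in S m.-1 n
    + (if m <= n then count_in_plain S m (n - m) else 0).*2.
Proof.
move=> m0 Sm; set F := first_part_seqs S m n.
have -> : count_in S m n = size
    (bounded_seqs n (overpartition_in S m.-1 n) ++ F false ++ F true).
  apply/perm_size/uniq_perm; rewrite ?bounded_seqs_uniq //.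
    rewrite !cat_uniq bounded_seqs_uniq !first_part_seqs_uniq /= andbT.
    apply/andP; split; apply/hasPn => -[|[p b] t].
    - by rewrite mem_cat !mem_first_part_seqs //= !xpair_eqE; lia.
    - rewrite mem_cat !mem_first_part_seqs //= mem_overpartition_in.
      by rewrite overpartition_in_cons !xpair_eqE; lia.
    - by rewrite mem_first_part_seqs //= !xpair_eqE; lia.
    - by rewrite !mem_first_part_seqs //= !xpair_eqE; lia.
  move=> [|[p b] t]; rewrite !mem_cat !mem_first_part_seqs //.
    rewrite !mem_overpartition_in !xpair_eqE /overpartition_in /=; lia.
  rewrite !mem_overpartition_in !overpartition_in_cons !xpair_eqE.
  case: (eqVneq p m) => [->|pm]; last by rewrite !andbF /= ; lia.
  by rewrite Sm; case: b => /=; lia.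
by rewrite !size_cat !size_first_part_seqs addnn.
Qed.

(** A leading [m] cannot be overlined here, so this case counts once. *)
Lemma count_in_plain_recl (S : pred nat) m n : 0 < m -> S m ->
  count_in_plain S m n = count_in S m.-1 n
    + (if m <= n then count_in_plain S m (n - m) else 0).
Proof.
move=> m0 Sm; set F := first_part_seqs S m n.
have -> : count_in_plain S m n = size
    (bounded_seqs n (overpartition_in S m.-1 n) ++ F false).
  apply/perm_size/uniq_perm; rewrite ?bounded_seqs_uniq //.
    rewrite !cat_uniq bounded_seqs_uniq !first_part_seqs_uniq /= andbT.
    apply/hasPn => -[|[p b] t]; rewrite !mem_first_part_seqs //= !xpair_eqE.
      by lia.
    by rewrite mem_overpartition_in overpartition_in_cons; lia.
  move=> [|[p b] t]; rewrite mem_overpartition_in_plain.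
    rewrite !mem_cat !mem_first_part_seqs // !mem_overpartition_in.
    by rewrite !xpair_eqE /overpartition_in_plain /overpartition_in /=; lia.
  rewrite overpartition_in_plain_cons // mem_cat mem_first_part_seqs //.
  rewrite mem_overpartition_in /= !xpair_eqE.
  case: (eqVneq p m) => [->|pm]; last by rewrite !andbF /= orbF.
  by rewrite overpartition_in_cons; case: b => /=; lia.
by rewrite size_cat size_first_part_seqs.
Qed.

Lemma count_in_skip (S : pred nat) m n : ~~ S m -> count_in S m n = count_in S m.-1 n.
Proof.
move=> Sm; congr size; rewrite /bounded_seqs; congr map.
apply: eq_enum => s; rewrite !inE /overpartition_in; congr (_ && _).
apply: eq_all => x /=; case: (boolP (S x.1)) => //= Sx.
have xm : x.1 != m by apply: contraNneq Sm => <-.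
by apply/idP/idP; lia.
Qed.

Lemma count_in0 (S : pred nat) n : count_in S 0 n = (n == 0).
Proof.
rewrite /count_in.
have E s : overpartition_in S 0 n s = (n == 0) && (s == [::]).
  case: s => [|[p b] t].
    by rewrite /overpartition_in /is_overpartition /= !andbT eq_sym.
  by rewrite overpartition_in_cons andbF; apply/negbTE; lia.
have -> : nat_of_bool (n == 0) =
    size (if n == 0 then [:: [::] : seq (nat * bool)] else [::]).
  by case: (n == 0).
apply/perm_size/uniq_perm; rewrite ?bounded_seqs_uniq //; first by case: ifP.
by move=> s; rewrite mem_overpartition_in E; case: (n == 0); rewrite ?inE.
Qed.

Lemma pbar_oE m n : n <= m -> pbar_o n = count_in odd m n.
Proof.
move=> nm; rewrite /pbar_o /count_in size_map cardE; congr size.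
apply: eq_enum => s; rewrite !inE /overpartition_in all_map; congr (_ && _).
apply: eq_all => x /=.
by rewrite (leq_trans _ nm) ?andbT // -ltnS ltn_ord.
Qed.

Lemma pbarE m n : n <= m -> pbar n%:Z%R = count_in predT m n.
Proof.
move=> nm; rewrite /= /count_in size_map cardE; congr size.
apply: eq_enum => s; rewrite !inE /overpartition_in all_map.
rewrite [X in _ && X](_ : _ = true) ?andbT //.
by apply/allP => x _ /=; rewrite (leq_trans _ nm) // -ltnS ltn_ord.
Qed.

(** * Congruence of polynomials modulo a power of X *)

Section Congruence.
Local Open Scope ring_scope.
Variable R : comNzRingType.
Implicit Types p q r : {poly R}.

Definition eq_modX (M : nat) p q := forall i, (i < M)%N -> p`_i = q`_i.

Lemma eq_modX_sym M p q : eq_modX M p q -> eq_modX M q p.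
Proof. by move=> pq i iM; rewrite pq. Qed.

Lemma eq_modX_trans M q p r : eq_modX M p q -> eq_modX M q r -> eq_modX M p r.
Proof. by move=> pq qr i iM; rewrite pq // qr. Qed.

Lemma eq_modX_leq M N p q : (N <= M)%N -> eq_modX M p q -> eq_modX N p q.
Proof. by move=> NM pq i iN; apply: pq; apply: leq_trans NM. Qed.

Lemma eq_modX_mul M p p' q q' :
  eq_modX M p p' -> eq_modX M q q' -> eq_modX M (p * q) (p' * q').
Proof.
move=> pp qq i iM; rewrite !coefM; apply: eq_bigr => j _.
by rewrite pp ?qq //; have := ltn_ord j; lia.
Qed.

Lemma eq_modX_mull M p q q' :
  eq_modX M q q' -> eq_modX M (p * q) (p * q').
Proof. exact: eq_modX_mul. Qed.

Lemma eq_modX_sum_nat M m n (F G : nat -> {poly R}) :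
  (forall i, (m <= i < n)%N -> eq_modX M (F i) (G i)) ->
  eq_modX M (\sum_(m <= i < n) F i) (\sum_(m <= i < n) G i).
Proof.
move=> FG i iM; rewrite !coef_sum big_nat [RHS]big_nat.
by apply: eq_bigr => j /FG; apply.
Qed.

Lemma eq_modX_mulXn M N p q :
  eq_modX M p q -> eq_modX (N + M) ('X^N * p) ('X^N * q).
Proof.
move=> pq i iM; rewrite !coefXnM; case: ltnP => // Ni.
by apply: pq; lia.
Qed.

Lemma eq_modX_mulI M p q r :
  p`_0 = 1 -> eq_modX M (p * q) (p * r) -> eq_modX M q r.
Proof.
move=> p0 pqr i; elim/ltn_ind: i => i IH iM.
have := pqr i iM; rewrite !coefM !big_ord_recl /= p0 !mul1r subn0.
suff -> : \sum_(j < i) p`_j.+1 * q`_(i - j.+1) =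
          \sum_(j < i) p`_j.+1 * r`_(i - j.+1) by move/addIr.
by apply: eq_bigr => -[j ji] _; rewrite /= IH //; lia.
Qed.

Lemma eq_modX_prod1 M n m (F : nat -> {poly R}) : (n <= m)%N ->
  (forall i, (n <= i < m)%N -> eq_modX M (F i) 1) ->
  eq_modX M (\prod_(0 <= i < m) F i) (\prod_(0 <= i < n) F i).
Proof.
move=> nm F1; rewrite (big_cat_nat (n := n)) //= -[X in eq_modX _ _ X]mulr1.
apply: eq_modX_mull; rewrite big_nat.
elim/big_ind: _ => // p q p1 q1; rewrite -[X in eq_modX _ _ X]mulr1.
exact: eq_modX_mul.
Qed.

Lemma eq_modX_comp_X2 M p q :
  eq_modX M p q -> eq_modX M.*2 (p \Po 'X^2) (q \Po 'X^2).
Proof.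
move=> pq i iM; rewrite !coef_comp_poly_Xn //; case: ifP => // _.
by apply: pq; lia.
Qed.

Lemma coef0_prod1 (I : eqType) (s : seq I) (F : I -> {poly R}) :
  (forall i, i \in s -> (F i)`_0 = 1) -> (\prod_(i <- s) F i)`_0 = 1.
Proof.
move=> F1; rewrite -horner_coef0 horner_prod big_seq big1 // => i /F1.
by rewrite horner_coef0.
Qed.

End Congruence.

(** * Gaussian binomials and the q-binomial theorem *)

Section GaussianBinomial.
Local Open Scope ring_scope.
Variable R : comNzRingType.
Variable t : R.

(** The q-Pascal rule makes sense in any commutative ring, without division. *)
Fixpoint gauss_binom (n k : nat) : R :=
  match n, k with
  | _, 0 => 1
  | 0, _.+1 => 0
  | n'.+1, k'.+1 => gauss_binom n' k' + t ^+ k * gauss_binom n' k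
  end.

(** The q-Pochhammer symbol (t;t)_n. *)
Definition qfact (n : nat) : R := \prod_(0 <= i < n) (1 - t ^+ i.+1).

Lemma qfactS n : qfact n.+1 = qfact n * (1 - t ^+ n.+1).
Proof. by rewrite /qfact big_nat_recr. Qed.

Lemma gauss_binom_small n k : (n < k)%N -> gauss_binom n k = 0.
Proof.
elim: n k => [|n IH] [|k] //= nk.
by rewrite !IH ?mulr0 ?addr0 //; lia.
Qed.

Lemma gauss_binomn0 n : gauss_binom n 0 = 1. Proof. by case: n. Qed.

(** Induction on [k + l]: the two q-Pascal terms add up because 1 - t^(a+b) = (1 - t^a) + t^a (1 -
    t^b). *)
Lemma gauss_binom_qfact k l :
  qfact k * qfact l * gauss_binom (k + l) k = qfact (k + l).
Proof.
have q0 : qfact 0 = 1 by rewrite /qfact big_nil.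
move: {2}(k + l)%N (erefl (k + l)%N) => n; elim: n k l => [|n IH] [|k] [|l] kl //.
- by rewrite q0 !mulr1.
- by rewrite q0 mul1r add0n mulr1.
- rewrite addn0 q0 mulr1 /= (@gauss_binom_small k k.+1) // mulr0 addr0.
  have := IH k 0%N; rewrite addn0 q0 mulr1 => H.
  by rewrite qfactS mulrAC H //; lia.
- have := IH k l.+1; have := IH k.+1 l.
  rewrite addSnnS !addSn => H1 H2 /=.
  have {}H1 := H1 ltac:(lia); have {}H2 := H2 ltac:(lia).
  rewrite !qfactS in H1 H2 *.
  transitivity (qfact (k + l.+1) * (1 - t ^+ k.+1)
                + qfact (k + l.+1) * (1 - t ^+ l.+1) * t ^+ k.+1).
    by rewrite -{1}H2 -H1; ring.
  by rewrite -addSn exprD; ring.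
Qed.

(* Homogeneous in (x, y) so that it can be used with y a power of t, where the
   usual form would need negative powers of t. *)
Lemma gauss_binom_theorem (x y : R) n :
  \prod_(0 <= i < n) (y + x * t ^+ i) =
  \sum_(0 <= k < n.+1) t ^+ 'C(k, 2) * gauss_binom n k * x ^+ k * y ^+ (n - k).
Proof.
elim: n x => [|n IH] x.
  by rewrite big_nil big_nat1 /= !mulr1.
(* Once the factor i = 0 is peeled off, the rest is the same product with [x * t] for [x]. *)
rewrite big_nat_recl // expr0 mulr1.
under eq_bigr => i _ do rewrite exprS mulrA.
rewrite IH mulrDl !mulr_sumr.
rewrite [in RHS]big_nat_recl //= expr0 !mul1r ?mulr1 subn0.
under [in RHS]eq_bigr => k _ do
  rewrite mulrDr [X in X * _]mulrDl mulrDl.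
rewrite big_split /= [X in _ = _ + X]addrC addrA.
congr (_ + _); last first.
  by apply: eq_bigr => k _; rewrite subSS binS bin1 exprD !exprS exprMn; ring.
rewrite big_nat_recl //= gauss_binomn0 expr0 !mul1r ?mulr1 subn0 exprS.
congr (_ + _).
rewrite [in RHS]big_nat_recr //= (@gauss_binom_small n n.+1) //.
rewrite !(mulr0, mul0r) addr0.
rewrite big_nat [in RHS]big_nat; apply: eq_bigr => k kn.
have -> : (n.+1 - k.+1 = (n - k.+1).+1)%N by lia.
by rewrite exprMn [y ^+ _.+1]exprS; ring.
Qed.

End GaussianBinomial.

(** * Truncated generating functions, triple product and Euler's identity *)

Section GeneratingFunctions.
Local Open Scope ring_scope.

Definition count_gf (S : pred nat) M m : {poly int} :=
  \poly_(n < M) (count_in S m n)%:R.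

(** Let [B] count the sequences that may follow a part [m]. Modulo X^M, [(1 - 'X^m) * B] is the
    series for [m.-1]. Adding twice ['X^m * B] gives the series for [m], namely [(1 + 'X^m) * B]. *)
Lemma count_gf_rec (S : pred nat) M m : (0 < m)%N -> S m ->
  eq_modX M ((1 - 'X^m) * count_gf S M m) ((1 + 'X^m) * count_gf S M m.-1).
Proof.
move=> m0 Sm; pose B : {poly int} := \poly_(n < M) (count_in_plain S m n)%:R.
have BE : eq_modX M ((1 - 'X^m) * B) (count_gf S M m.-1).
  move=> i iM; rewrite mulrBl mul1r coefB coefXnM !coef_poly iM.
  rewrite count_in_plain_recl //; case: ltnP => im.
    by rewrite addn0 subr0.
  by rewrite natrD ifT ?addrK //; lia.
have AE : eq_modX M (count_gf S M m) ((1 + 'X^m) * B).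
  move=> i iM; rewrite mulrDl mul1r coefD coefXnM !coef_poly iM.
  rewrite count_in_recl // (count_in_plain_recl i m0 Sm); case: ltnP => im.
    by rewrite !addn0 addr0.
  by rewrite ifT -?natrD ?addnn -?addnA ?addnn //; lia.
apply: eq_modX_trans (eq_modX_mull (1 - 'X^m) AE) _.
by rewrite mulrCA; apply: eq_modX_mull.
Qed.

Lemma count_gf_prod (S : pred nat) M m : (0 < M)%N ->
  eq_modX M (\prod_(0 <= i < m | S i.+1) (1 - 'X^(i.+1)) * count_gf S M m)
            (\prod_(0 <= i < m | S i.+1) (1 + 'X^(i.+1))).
Proof.
move=> M0; elim: m => [|m IH].
  rewrite !big_nil mul1r => i iM; rewrite coef_poly iM coef1 count_in0.
  by case: eqP.
have recr (F : nat -> {poly int}) : \prod_(0 <= i < m.+1 | S i.+1) F i =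
    \prod_(0 <= i < m | S i.+1) F i * (if S m.+1 then F m else 1).
  by rewrite big_mkcond big_nat_recr //= -big_mkcond.
rewrite !recr; case: ifP => [Sm|/negbT Sm].
  rewrite -mulrA.
  apply: eq_modX_trans (eq_modX_mull _ (count_gf_rec (ltn0Sn m) Sm)) _ => /=.
  by rewrite mulrCA mulrC; apply: eq_modX_mul.
rewrite !mulr1; suff -> : count_gf S M m.+1 = count_gf S M m by [].
by apply/polyP => i; rewrite !coef_poly count_in_skip.
Qed.

Lemma prod_odd N (F : nat -> {poly int}) :
  \prod_(0 <= i < N.*2 | odd i.+1) F i.+1 = \prod_(0 <= i < N) F i.*2.+1.
Proof.
elim: N => [|N IH]; first by rewrite !big_nil.
rewrite doubleS big_mkcond !big_nat_recr //= -big_mkcond /= IH odd_double /=.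
by rewrite mulr1.
Qed.

Lemma prod_even_odd N (F : nat -> {poly int}) :
  \prod_(0 <= i < N.*2) F i.+1 =
  \prod_(0 <= i < N) F i.*2.+1 * \prod_(0 <= i < N) F i.*2.+2.
Proof.
elim: N => [|N IH]; first by rewrite !big_nil mulr1.
by rewrite doubleS !big_nat_recr //= IH; ring.
Qed.

(** One of the two truncated differences is 0, so their sum is |k - N|. *)
Definition sqdist (k N : nat) : nat := ((k - N) + (N - k)) ^ 2.

(* The finite Jacobi triple product at z = 1: the q-binomial theorem for
   q^2, x = q, y = q^(2N) and exponent 2N, divided by q^(3N^2). *)
Lemma prod_odd_sqr N :
  (\prod_(0 <= i < N) (1 + 'X^(i.*2.+1) : {poly int})) ^+ 2 =
  \sum_(0 <= k < N.*2.+1) 'X^(sqdist k N) * gauss_binom 'X^2 N.*2 k.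
Proof.
have Xn0 : 'X^(3 * N ^ 2) != 0 :> {poly int} by rewrite monic_neq0 // monicXn.
apply: (mulfI Xn0).
transitivity (\prod_(0 <= i < N.*2) ('X^(N.*2) + 'X * 'X^2 ^+ i : {poly int})).
  (* For i < N the power q^(2i+1) comes out of the factor, in total q^(N^2). For i >= N it is
     q^(2N), in total q^(2N^2). Each half leaves one copy of the odd product. *)
  rewrite (big_cat_nat (n := N) (p := N.*2)) //=; last by lia.
  rewrite -addnn.
  have -> : \prod_(0 <= i < N) ('X^(N + N) + 'X * 'X^2 ^+ i) =
     'X^(N ^ 2) * \prod_(0 <= i < N) (1 + 'X^(i.*2.+1)) :> {poly int}.
    rewrite [X in _ = _ * X]big_nat_rev /= add0n.
    have -> : 'X^(N ^ 2) = \prod_(0 <= i < N) 'X^(i.*2.+1) :> {poly int}.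
      elim: (N) => [|k IH]; first by rewrite big_nil.
      rewrite big_nat_recr //= -IH -exprD; congr ('X^_); lia.
    rewrite -big_split /= big_nat [RHS]big_nat; apply: eq_bigr => i iN.
    rewrite mulrDr mulr1 -exprD -exprM -exprS addrC.
    by congr ('X^_ + 'X^_); lia.
  have -> : \prod_(N <= i < N + N) ('X^(N + N) + 'X * 'X^2 ^+ i) =
     'X^(2 * N ^ 2) * \prod_(0 <= i < N) (1 + 'X^(i.*2.+1)) :> {poly int}.
    rewrite -{1}[N]add0n big_addn addnK.
    have -> : 'X^(2 * N ^ 2) = \prod_(0 <= i < N) 'X^(N + N) :> {poly int}.
      by rewrite prodr_const_nat subn0 -exprM; congr ('X^_); lia.
    rewrite -big_split /=; apply: eq_bigr => i _.
    by rewrite mulrDr mulr1 -exprD -exprM -exprS; congr ('X^_ + 'X^_); lia.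
  by rewrite mulrACA -exprD -expr2; congr ('X^_ * _); lia.
rewrite gauss_binom_theorem mulr_sumr big_nat [RHS]big_nat.
apply: eq_bigr => k kN; rewrite mulrA -[in RHS]exprD.
rewrite [_ * gauss_binom _ _ _ * _]mulrAC [LHS]mulrAC; congr (_ * _).
rewrite -!exprM -!exprD; congr ('X^_).
(* The exponents agree as k(k-1) + k + 2N(2N-k) = 3N^2 + (k-N)^2. *)
have : ('C(k, 2) * 2 = k * k.-1)%N.
  by elim: (k) => // -[//|j] IH; rewrite binS bin1; nia.
rewrite /sqdist; case: (leqP k N) => kn; nia.
Qed.

(** The factors dropped are 1 - X^(2i+2) with i >= r. *)
Lemma qfact_modX r a : (r <= a)%N ->
  eq_modX r.*2.+2 (qfact ('X^2 : {poly int}) a) (qfact 'X^2 r).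
Proof.
move=> ra; apply: eq_modX_prod1 => // i ri j jr.
rewrite coefB -exprM coefXn (_ : j == _ = false) ?subr0 //; lia.
Qed.

Lemma qfact_coef0 r : (qfact ('X^2 : {poly int}) r)`_0 = 1.
Proof.
apply: coef0_prod1 => i _.
by rewrite coefB -exprM coefXn coef1 mulnS subr0.
Qed.

(** With r the minimum, (q^2;q^2)_m is the same modulo X^(2r+2) for m = r, k, 2N-k, N and 2N. The
    closed form of the binomial then yields the claim after cancelling [q r]. *)
Lemma gauss_binom_modX N k : (k <= N.*2)%N ->
  eq_modX (minn k (N.*2 - k)).*2.+2
    (qfact ('X^2 : {poly int}) N * gauss_binom 'X^2 N.*2 k) 1.
Proof.
move=> kN; set r := minn _ _; set q := qfact _.
have rN : (r <= N)%N by lia.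
have := gauss_binom_qfact ('X^2 : {poly int}) k (N.*2 - k).
rewrite -/q subnKC // => E.
apply: (eq_modX_mulI (qfact_coef0 r)); rewrite mulr1 -/q.
apply: eq_modX_trans (_ : eq_modX _ (q k * q (N.*2 - k)%N * gauss_binom 'X^2 N.*2 k) _).
  rewrite mulrA; apply: eq_modX_mul => //; apply: eq_modX_mul.
    by apply: eq_modX_sym; apply: qfact_modX; lia.
  apply: (eq_modX_trans (q := q r)); first exact: qfact_modX.
  by apply: eq_modX_sym; apply: qfact_modX; lia.
by rewrite E; apply: qfact_modX; lia.
Qed.

Lemma theta_modX N :
  eq_modX N.*2
    ((\prod_(0 <= i < N) (1 + 'X^(i.*2.+1) : {poly int})) ^+ 2 * qfact 'X^2 N)
    (\sum_(0 <= k < N.*2.+1) 'X^(sqdist k N)).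
Proof.
rewrite prod_odd_sqr mulr_suml; apply: eq_modX_sum_nat => k /andP[_ kN].
rewrite -mulrA -[X in eq_modX _ _ X]mulr1.
(* With d = |k - N| the minimum is N - d, and d^2 + 2(N-d) + 2 = 2N + 1 + (d-1)^2. *)
apply: (eq_modX_leq (M := sqdist k N + (minn k (N.*2 - k)).*2.+2)).
  rewrite /sqdist; case: (leqP k N) => kn; nia.
by apply: eq_modX_mulXn; rewrite mulrC; apply: gauss_binom_modX; lia.
Qed.

(** After multiplication by (q^2;q^2)_N, differences of squares give the factors 1 - q^(4i+2) and 1
    - q^(4i+4), which together form (q^2;q^2)_(2N). Modulo X^(2N) this is (q^2;q^2)_N again, which
    cancels. *)
Lemma euler_modX N :
  eq_modX N.*2 (\prod_(0 <= i < N) (1 - 'X^(i.*2.+1) : {poly int})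
    * \prod_(0 <= i < N) (1 + 'X^(i.*2.+1))
    * \prod_(0 <= i < N) (1 + 'X^2 ^+ i.+1)) 1.
Proof.
apply: (eq_modX_mulI (qfact_coef0 N)); rewrite mulr1.
set q := qfact _ N; set a := \prod_(_ <= _ < _) _; set b := \prod_(_ <= _ < _) _.
set c := \prod_(_ <= _ < _) _.
suff -> : q * (a * b * c) = qfact 'X^2 N.*2.
  by apply: eq_modX_leq (qfact_modX (r := N) _); lia.
rewrite mulrCA /qfact (prod_even_odd _ (fun i => 1 - 'X^2 ^+ i)).
congr (_ * _).
  rewrite /a /b -big_split /=.
  apply: eq_bigr => i _; rewrite -!exprM -subr_sqr expr1n -exprM.
  by congr (1 - 'X^_); lia.
rewrite /q /c /qfact -big_split /=.
apply: eq_bigr => i _; rewrite -!exprM -subr_sqr expr1n -exprM.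
by congr (1 - 'X^_); lia.
Qed.

(** Modulo X^(2N), [D * T * P2] becomes [D * C ^+ 2 * qfact 'X^2 N * P2] by the triple product, then
    [C * (D * C * F)], then [C] by Euler, which is [D * O]. Finally [D] cancels. *)
Lemma count_gf_odd_theta N : (0 < N)%N ->
  eq_modX N.*2 (count_gf odd N.*2 N.*2)
    ((\sum_(0 <= k < N.*2.+1) 'X^(sqdist k N)) * (count_gf predT N N \Po 'X^2)).
Proof.
move=> N0; set T := \sum_(_ <= _ < _) _; set P2 := _ \Po _.
set O := count_gf _ _ _.
pose D : {poly int} := \prod_(0 <= i < N) (1 - 'X^(i.*2.+1)).
pose C : {poly int} := \prod_(0 <= i < N) (1 + 'X^(i.*2.+1)).
pose F : {poly int} := \prod_(0 <= i < N) (1 + 'X^2 ^+ i.+1).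
have DO : eq_modX N.*2 (D * O) C.
  have := @count_gf_prod odd N.*2 N.*2; rewrite double_gt0 => /(_ N0).
  by rewrite (prod_odd N (fun i => 1 - 'X^i)) (prod_odd N (fun i => 1 + 'X^i)).
(* Substituting X^2 for X doubles the precision from N to 2N. *)
have EP : eq_modX N.*2 (qfact 'X^2 N * P2) F.
  have := eq_modX_comp_X2 (@count_gf_prod predT N N N0).
  rewrite rmorphM !rmorph_prod /= -/P2.
  rewrite (eq_bigr (fun i => 1 - 'X^2 ^+ i.+1)) => [|i _]; last first.
    by rewrite rmorphB rmorph1 /= comp_Xn_poly.
  rewrite -/(qfact _ _) [X in eq_modX _ _ X](eq_bigr (fun i => 1 + 'X^2 ^+ i.+1)) //.
  by move=> i _; rewrite rmorphD rmorph1 /= comp_Xn_poly.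
have D0 : D`_0 = 1.
  by apply: coef0_prod1 => i _; rewrite coefB coefXn coef1 subr0.
apply: (eq_modX_mulI D0); apply: eq_modX_trans DO _; apply: eq_modX_sym.
apply: (eq_modX_trans (q := D * (C ^+ 2 * qfact 'X^2 N * P2))).
  apply: eq_modX_mull; apply: eq_modX_mul => //; apply: eq_modX_sym.
  exact: theta_modX.
apply: (eq_modX_trans (q := C * (D * C * F))).
  have -> : C * (D * C * F) = D * C ^+ 2 * F by ring.
  by rewrite -(mulrA (C ^+ 2)) (mulrA D (C ^+ 2)); apply: eq_modX_mull.
rewrite -[X in eq_modX _ _ X]mulr1; apply: eq_modX_mull.
exact: euler_modX.
Qed.

End GeneratingFunctions.

(** * Extraction of the coefficient of odd degree *)

Lemma sum_distn N (h : nat -> nat) : h 0 = 0 ->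
  \sum_(0 <= k < N.*2.+1) h ((k - N) + (N - k)) = 2 * \sum_(0 <= j < N.+1) h j.
Proof.
(* The indices k < N give the distances 1 to N, and k >= N give 0 to N; the extra distance 0 costs
   nothing since [h 0 = 0]. *)
move=> h0; rewrite (big_cat_nat (n := N)) //=; last by lia.
rewrite big_nat_rev /= add0n -[X in index_iota X N.*2.+1]add0n big_addn.
have -> : N.*2.+1 - N = N.+1 by lia.
rewrite mul2n -addnn; congr (_ + _); last first.
  by apply: eq_bigr => j _; congr h; lia.
rewrite [RHS]big_nat_recl //= h0 add0n big_nat [RHS]big_nat.
by apply: eq_bigr => j jN; congr h; lia.
Qed.

Lemma sum_odd_support N (h : nat -> nat) :
  (forall j, ~~ odd j -> h j = 0) ->
  \sum_(0 <= j < N.*2) h j = \sum_(0 <= m < N) h m.*2.+1.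
Proof.
move=> h0; elim: N => [|N IH]; first by rewrite !big_nil.
by rewrite doubleS !big_nat_recr //= IH h0 ?odd_double ?addn0.
Qed.

Theorem theorem3p6 (n : nat) :
  pbar_o (2 * n + 1) =
  2 * \big[addn/0]_(k \in [set: nat]%classic)
        pbar (n%:Z - (2 * k * (k + 1))%N%:Z)%R.
Proof.
(* This choice puts the degree 2n+1 just below the precision 2N. *)
set N := n.+1.
(* [h d] is the contribution to degree 2n+1 of a single theta term q^(d^2). *)
pose h d := if odd d && (d ^ 2 <= 2 * n + 1)
  then count_in predT N (2 * n + 1 - d ^ 2)./2 else 0.
have h_even j : ~~ odd j -> h j = 0 by rewrite /h => /negbTE ->.
have h_odd m : h m.*2.+1 = pbar (n%:Z - (2 * m * (m + 1))%N%:Z)%R.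
  have sq : m.*2.+1 ^ 2 = 2 * (2 * m * (m + 1)) + 1 by lia.
  rewrite /h sq /= odd_double /=; case: leqP => mn.
    rewrite subzn; last by lia.
    rewrite (@pbarE N); last by rewrite /N; lia.
    by congr count_in; lia.
  (* The argument is negative here, where [pbar] is 0 by definition. *)
  suff [r ->] : exists r, (n%:Z - (2 * m * (m + 1))%N%:Z)%R = Negz r by [].
  by exists (2 * m * (m + 1) - n).-1; rewrite NegzE; lia.
have -> : \big[addn/0]_(k \in [set: nat]%classic)
    pbar (n%:Z - (2 * k * (k + 1))%N%:Z)%R = \sum_(0 <= k < N) h k.*2.+1.
  rewrite (eq_bigr _ (fun k _ => h_odd k)) big_mkord.
  rewrite (fsbig_ord _ _ (fun k => pbar (n%:Z - (2 * k * (k + 1))%N%:Z)%R)).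
  apply/esym/fsbig_widen => // k [_ /= /negP].
  by rewrite -leqNgt => nk; apply: pbar_summand_eq0.
rewrite -sum_odd_support // (big_cat_nat (n := N.+1)) //=; last by rewrite /N; lia.
(* For j >= n+2 the square exceeds 2n+1. What remains is the range 0 to N of the distances |k -
   N|. *)
have -> : \sum_(N.+1 <= j < N.*2) h j = 0.
  rewrite big_nat big1 // => j /andP[nj _].
  rewrite /h ifF //; apply/negbTE; rewrite negb_and -ltnNge.
  by have := leq_mul nj nj; rewrite -mulnn; lia.
rewrite addn0.
rewrite -sum_distn ?h_even //.
apply/eqP; rewrite -(Num.Theory.eqr_nat int); apply/eqP.
rewrite natr_sum.
have := @count_gf_odd_theta N (ltn0Sn n) (2 * n + 1).
rewrite {1}/count_gf coef_poly => H.
have {}H := H ltac:(lia); move: H.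
rewrite ifT; last by lia.
rewrite -pbar_oE; last by lia.
move=> ->; rewrite mulr_suml coef_sum; apply: eq_bigr => k _.
rewrite coefXnM -/(sqdist k N) /h /sqdist; set d := (k - N + _).
case: ltnP => dn; first by rewrite andbF.
(* A series in X^2 has only even degrees, and 2n+1 - d^2 is even exactly when d is odd. *)
rewrite andbT coef_comp_poly_Xn // coef_poly dvdn2 oddB // oddX /=.
rewrite mul2n addn1 /= odd_double /= divn2.
case: (odd d) => //=.
by rewrite ifT //; rewrite /N; lia.
Qed.
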